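(* Let $M$ be an oriented $3$-valent map. Then: (i) for corners $c,c',c''$ at a common vertex, $sh(c,c'')\equiv sh(c,c')+sh(c',c'')\pmod 3$; (ii) for any function $\phi:V(M)\to Corner(M)$ such that $\phi(v)$ is a corner at $v$ for every $v$, and any $f\in OrMap(M)$, the residue $\sum_{v\in V(M)} sh\big(f(\phi(v)),\phi(f(v))\big)\pmod 3$ does not depend on $\phi$; denote it $sh(f)\in\mathbb{Z}_3$; (iii) for $f,g\in OrMap(M)$, $sh(f\circ g)\equiv sh(f)+sh(g)\pmod 3$; (iv) $sh$ is not identically $0$ on $OrMap(M)$; (v) every $f\in Rubik(M)$ (acting on corners) satisfies $sh(f)\equiv 0\pmod 3$.
   Context: A $3$-valent map $M$ is a cellularly embedded $3$-regular graph on a surface; $V(M)$, $E(M)$, $Face(M)$ denote its vertices, edges and faces. Throughout, every face boundary is a simple cycle, every edge lies in two distinct faces, and the three faces at any vertex are pairwise distinct. A corner is a pair $(F,v)$ with $v$ a vertex of the face $F$; $Corner(M)$ is the set of corners, and each vertex $v$ lies in exactly three corners $C_v$. Side movement: let $F$ have boundary cycle $v_1,\dots,v_p$ (indices mod $p$, in a chosen direction), edges $e_i=v_iv_{i+1}$, and let $G_i$ be the face other than $F$containing $e_i$. The side movement $sm(M,F)$ permutes corners by $(F,v_i)\mapsto(F,v_{i+1})$, $(G_{i-1},v_i)\mapsto(G_i,v_{i+1})$, $(G_i,v_i)\mapsto(G_{i+1},v_{i+1})$, fixing all other corners (it also permutes side edges $(F,e_i)\mapsto(F,e_{i+1})$,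 $(G_i,e_i)\mapsto(G_{i+1},e_{i+1})$). $Rubik(M)$ is the group generated by all $sm(M,F)$, $F\in Face(M)$. When $M$ is oriented, the orientation gives a cyclic (''direct'') order on each $C_v$; let $r$ be the rotation of $C_v$ advancing one step in this order. $OrMap(M)$ is the set of permutations of $Corner(M)$ that map each triple $C_v$ onto some triple $C_{v'}$ preserving the cyclic orders (such $f$ induces a permutation $v\mapsto f(v)$ of $V(M)$). For corners $c,c'$ at the same vertex, $sh(c,c')$ is the $k\in\{0,1,2\}$ with $r^k(c)=c'$. *)

(* Defs.v *)
From HB Require Import structures.
From mathcomp Require Import all_boot all_order all_algebra all_fingroup.

Set Implicit Arguments.
Unset Strict Implicit.
Unset Printing Implicit Defensive.

Import GRing.Theory.

(** A finite map on a closed oriented surface, given by its rotation system.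
    A dart is an edge with a choice of one of its two ends; [drot] turns a dart
    to the next one around its origin in the direct sense, and [dopp] exchanges
    the two darts of an edge.  Vertices and edges are the orbits of [drot] and
    [dopp].  The face lying to the left of a dart [d] is the orbit of [d] under
    [fperm], which maps [d] to [drot^-1 (dopp d)] ([*] on permutations composes
    from left to right): walk along [d], then leave the vertex reached by the
    dart having the same face on its left. *)
Record oriented_map := OrientedMap {
  dart : finType;
  drot : {perm dart};
  dopp : {perm dart};
  dart_gt0 : 0 < #|dart|;
  dopp_neq : forall d, dopp d != d;
  doppK : forall d, dopp (dopp d) = d
}.

Definition fperm (M : oriented_map) : {perm dart M} := (dopp M * (drot M)^-1)%g.

Definition vertex (M : oriented_map) :=
  {v : {set dart M} | v \in porbits (drot M)}.
Definition edge (M : oriented_map) :=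
  {e : {set dart M} | e \in porbits (dopp M)}.
Definition face (M : oriented_map) :=
  {F : {set dart M} | F \in porbits (fperm M)}.

Section Incidence.
Variable M : oriented_map.
Implicit Type d : dart M.

Definition vtx d : vertex M := exist (fun v => v \in porbits (drot M)) _
  (imset_f (porbit (drot M)) (isT : d \in dart M)).
Definition edg d : edge M := exist (fun e => e \in porbits (dopp M)) _
  (imset_f (porbit (dopp M)) (isT : d \in dart M)).
Definition fac d : face M := exist (fun F => F \in porbits (fperm M)) _
  (imset_f (porbit (fperm M)) (isT : d \in dart M)).

(** The boundary of [F] meets [v] (resp. [e]) once for every dart of [F]
    having origin [v] (resp. carried by [e]). *)
Definition on_vertex (F : face M) (v : vertex M) := val F :&: val v.
Definition on_edge (F : face M) (e : edge M) := val F :&: val e.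

Definition corner := {c : face M * vertex M | on_vertex c.1 c.2 != set0}.
Definition side_edge := {s : face M * edge M | on_edge s.1 s.2 != set0}.

Definition cface (c : corner) : face M := (val c).1.
Definition cvert (c : corner) : vertex M := (val c).2.
Definition corners_at (v : vertex M) : {set corner} := [set c | cvert c == v].

Lemma on_vertexP d : on_vertex (fac d) (vtx d) != set0.
Proof. by apply/set0Pn; exists d; rewrite inE !porbit_id. Qed.

Definition dcorner d : corner :=
  exist (fun c => on_vertex c.1 c.2 != set0) (fac d, vtx d) (on_vertexP d).

Definition cdart (c : corner) : dart M := xchoose (set0Pn _ (valP c)).

(** The three corners at a vertex in direct order are those of [d], [drot d]
    and [drot (drot d)], the corner of a dart [d] being the sector between [d]
    and [drot d], to the left of [d]. *)
Definition crot (c : corner) : corner := dcorner (drot M (cdart c)).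

Definition sh (c c' : corner) : nat :=
  oapp (@nat_of_ord 3) 0 [pick k : 'I_3 | iter k crot c == c'].

Definition OrMap : {set {perm corner}} :=
  [set f : {perm corner} |
    [forall v, exists v', f @: corners_at v == corners_at v']
    && [forall c, f (crot c) == crot (f c)]].

Definition vact (f : {perm corner}) (v : vertex M) : vertex M :=
  odflt v [pick v' | f @: corners_at v == corners_at v'].

Definition corner_choice (phi : vertex M -> corner) : Prop :=
  forall v, cvert (phi v) = v.

Definition sh_sum (phi : vertex M -> corner) (f : {perm corner}) : 'Z_3 :=
  (\sum_(v : vertex M) (sh (f (phi v)) (phi (vact f v)))%:R)%R.

Lemma vertex_dart (v : vertex M) : exists d, d \in val v.
Proof. by case: v => v /= /imsetP[d _ ->]; exists d; apply: porbit_id. Qed.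

Definition some_corner (v : vertex M) : corner :=
  dcorner (xchoose (vertex_dart v)).

Lemma some_cornerP : corner_choice some_corner.
Proof.
move=> v; rewrite /some_corner; move: (xchooseP (vertex_dart v)).
move: (xchoose _) => d dv; apply: val_inj => /=.
by case: v dv => /= v /imsetP[x _ ->]; rewrite -eq_porbit_mem => /eqP.
Qed.

(** [sh_sum phi f] is independent of the corner choice [phi] when [f] is in
    [OrMap]; any [phi] may be used to define the residue. *)
Definition sh_map (f : {perm corner}) : 'Z_3 := sh_sum some_corner f.

End Incidence.

(** Oriented 3-valent maps under the standing assumptions: face boundaries are
    simple cycles, the two sides of every edge are distinct faces, and the
    three faces at every vertex are distinct. *)
Record cubic_map := CubicMap {
  base_map :> oriented_map;
  cubicP : forall d : dart base_map, #|porbit (drot base_map) d| = 3;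
  face_simple : forall (F : face base_map) v, #|on_vertex F v| <= 1;
  edge_faces : forall d : dart base_map, fac d != fac (dopp base_map d);
  vertex_faces : forall d d' : dart base_map,
    vtx d = vtx d' -> d != d' -> fac d != fac d'
}.

Section SideMovement.
Variable M : cubic_map.
Implicit Types (d x : dart M) (F : face M) (b : bool).

(** Let [F] have boundary v_1, ..., v_p in the direct direction ([b = true],
    [F] on the left) or the opposite one ([b = false]).  If [d] is the dart of
    [F] with origin v_i, then [bnext b d] is the one with origin v_(i+1),
    [along b d] is the dart of [F] carried by e_i = v_i v_(i+1), and
    [across b d] is the face G_i other than [F] containing e_i. *)
Definition bnext b : {perm dart M} := if b then fperm M else (fperm M)^-1%g.
Definition along b d : dart M := if b then d else (fperm M)^-1%g d.
Definition across b d : face M := fac (dopp M (along b d)).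

(** The pairs passed to [insubd] are always incident, so its default is never
    used; likewise the innermost [else] branches are unreachable. *)
Definition sm_corner b F (c : corner M) : corner M :=
  if [pick d in on_vertex F (cvert c)] is Some d then
    let v' := vtx (bnext b d) in
    if cface c == F then insubd c (F, v')
    else if cface c == across b ((bnext b)^-1%g d) then insubd c (across b d, v')
    else if cface c == across b d then insubd c (across b (bnext b d), v')
    else c
  else c.

Definition sm_side b F (s : side_edge M) : side_edge M :=
  if [pick x in on_edge F (val s).2] is Some x then
    let e' := edg (bnext b x) in
    if (val s).1 == F then insubd s (F, e')
    else if (val s).1 == fac (dopp M x) then
      insubd s (fac (dopp M (bnext b x)), e')
    else s
  else s.

Lemma fpermE d : fperm M d = (drot M)^-1%g (dopp M d).
Proof. by rewrite permM. Qed.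

Lemma fpermVE d : (fperm M)^-1%g d = dopp M (drot M d).
Proof. by apply: (@perm_inj _ (fperm M)); rewrite permKV fpermE doppK permK. Qed.

Lemma rot3 d : drot M (drot M (drot M d)) = d.
Proof. by have := iter_porbit (drot M) d; rewrite cubicP. Qed.

Lemma rotVE d : (drot M)^-1%g d = drot M (drot M d).
Proof. by rewrite -{1}[d]rot3 permK. Qed.

Lemma vtx_eq d d' : (vtx d == vtx d') = (d \in porbit (drot M) d').
Proof. by rewrite -eq_porbit_mem. Qed.

Lemma fac_eq d d' : (fac d == fac d') = (d \in porbit (fperm M) d').
Proof. by rewrite -eq_porbit_mem. Qed.

Lemma edg_eq d d' : (edg d == edg d') = (d \in porbit (dopp M) d').
Proof. by rewrite -eq_porbit_mem. Qed.

Lemma face_eq F d : d \in val F -> F = fac d.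
Proof.
case: F => /= F FP dF; apply: val_inj => /=.
case/imsetP: FP dF => x _ ->; rewrite -eq_porbit_mem.
by move/eqP->.
Qed.

Lemma vertex_eq (v : vertex M) d : d \in val v -> v = vtx d.
Proof.
case: v => /= v vP dv; apply: val_inj => /=.
by case/imsetP: vP dv => x _ ->; rewrite -eq_porbit_mem => /eqP->.
Qed.

Lemma edge_eq (e : edge M) d : d \in val e -> e = edg d.
Proof.
case: e => /= e eP de; apply: val_inj => /=.
by case/imsetP: eP de => x _ ->; rewrite -eq_porbit_mem => /eqP->.
Qed.

Lemma vtx_rot d : vtx (drot M d) = vtx d.
Proof. by apply/eqP; rewrite vtx_eq (mem_porbit _ 1). Qed.

Lemma fac_fperm d : fac (fperm M d) = fac d.
Proof. by apply/eqP; rewrite fac_eq (mem_porbit _ 1). Qed.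

Lemma fac_next b d : fac (bnext b d) = fac d.
Proof.
case: b; first exact: fac_fperm.
by rewrite /bnext -[in RHS](permKV (fperm M) d) fac_fperm.
Qed.

Lemma edg_opp d : edg (dopp M d) = edg d.
Proof. by apply/eqP; rewrite edg_eq (mem_porbit _ 1). Qed.

Lemma edgeP d d' : edg d = edg d' -> d' = d \/ d' = dopp M d.
Proof.
move/esym/eqP; rewrite edg_eq => /porbitP[i ->].
elim: i => [|i IH]; first by rewrite perm1; left.
by rewrite expgSr permM; case: IH => ->; [right | left; rewrite doppK].
Qed.

Lemma vertexP d d' : vtx d = vtx d' ->
  [\/ d' = d, d' = drot M d | d' = drot M (drot M d)].
Proof.
move/esym/eqP; rewrite vtx_eq porbit_traject cubicP !inE.
by case/or3P=> /eqP->; [constructor 1 | constructor 2 | constructor 3].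
Qed.

Lemma rot_neq d : (d != drot M d) && (d != drot M (drot M d)).
Proof.
have := uniq_traject_porbit (drot M) d; rewrite cubicP /= !inE !negb_or.
by case/and3P.
Qed.

Lemma dcorner_inj : injective (@dcorner M).
Proof.
move=> d d' E; have Ef : fac d = fac d' by exact: (congr1 (@cface M) E).
have Ev : vtx d = vtx d' by exact: (congr1 (@cvert M) E).
apply/eqP; apply: contraT => ne; have := vertex_faces Ev ne.
by rewrite Ef eqxx.
Qed.

Lemma cdartK : cancel (@cdart M) (@dcorner M).
Proof.
move=> c; apply: val_inj; rewrite /cdart /=.
move: (xchooseP (set0Pn _ (valP c))); move: (xchoose _) => d.
rewrite inE => /andP[dF dv]; rewrite -(face_eq dF) -(vertex_eq dv).
by rewrite -surjective_pairing.
Qed.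

Lemma dcornerK : cancel (@dcorner M) (@cdart M).
Proof. by move=> d; apply: dcorner_inj; rewrite cdartK. Qed.

Lemma pick_vertex F (v : vertex M) d : d \in val F -> d \in val v ->
  [pick x in on_vertex F v] = Some d.
Proof.
move=> dF dv; case: pickP => [x xP|/(_ d)]; last by rewrite inE dF dv.
have dP : d \in on_vertex F v by rewrite inE dF.
by have /card_le1_eqP/(_ x d xP dP)-> := face_simple F v.
Qed.

Lemma pick_edge F d : fac d = F -> [pick x in on_edge F (edg d)] = Some d.
Proof.
move=> <-; case: pickP => [x|/(_ d)]; last by rewrite inE !porbit_id.
rewrite inE => /andP[/face_eq xF /edge_eq/edgeP[-> //| xd]].
by have := edge_faces d; rewrite -xd xF eqxx.
Qed.

Lemma sm_cornerE b F d : fac d = F ->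
  [/\ sm_corner b F (dcorner d) = dcorner (bnext b d),
      sm_corner b F (dcorner (drot M d)) = dcorner (drot M (bnext b d)) &
      sm_corner b F (dcorner (drot M (drot M d)))
        = dcorner (drot M (drot M (bnext b d)))].
Proof.
move=> dF; have dinF : d \in val F by rewrite -dF porbit_id.
have dv : d \in val (vtx d) by exact: porbit_id.
have [n1 n2] := andP (rot_neq d).
have f1 : fac (drot M d) != F.
  by rewrite -dF eq_sym; apply: vertex_faces; rewrite ?vtx_rot.
have f2 : fac (drot M (drot M d)) != F.
  by rewrite -dF eq_sym; apply: vertex_faces; rewrite ?vtx_rot.
have f3 : fac (drot M (drot M d)) == fac (drot M d) = false.
  apply/negbTE; rewrite eq_sym; apply: vertex_faces; first by rewrite !vtx_rot.
  by apply: contra_neq n1 => /perm_inj.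
have R x : fac (dopp M x) = fac (drot M (drot M (x))).
  by rewrite -fac_fperm fpermE doppK rotVE.
have L x : fac (dopp M ((fperm M)^-1%g x)) = fac (drot M x).
  by rewrite fpermVE doppK.
have ins c0 x K : fac x = K -> vtx x = vtx (bnext b d) ->
  insubd c0 (K, vtx (bnext b d)) = dcorner x.
  move=> <- <-; apply: val_inj; rewrite val_insubd /=.
  by rewrite on_vertexP.
rewrite /sm_corner; split.
- rewrite /cvert /cface /= (pick_vertex dinF) // dF eqxx.
  by apply: ins; rewrite // fac_next.
- rewrite /cvert /cface /= vtx_rot (pick_vertex dinF) // (negbTE f1).
  rewrite /across /along; case: b ins => ins.
    rewrite L eqxx; apply: ins; last by rewrite vtx_rot.
    by rewrite fpermE permKV.
  rewrite /bnext invgK permK R eq_sym f3 L eqxx.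
  by apply: ins; rewrite ?vtx_rot // L.
- rewrite /cvert /cface /= !vtx_rot (pick_vertex dinF) // (negbTE f2).
  rewrite /across /along; case: b ins => ins.
    rewrite L f3 R eqxx; apply: ins; last by rewrite !vtx_rot.
    by rewrite R.
  rewrite /bnext invgK permK R eqxx.
  by apply: ins; rewrite ?vtx_rot // R.
Qed.

Lemma sm_corner_off b F c : on_vertex F (cvert c) = set0 -> sm_corner b F c = c.
Proof. by move=> E; rewrite /sm_corner E; case: pickP => // x; rewrite inE. Qed.

Lemma next_negb b d : bnext b (bnext (~~ b) d) = d.
Proof. by case: b; rewrite /= ?permK ?permKV. Qed.

Lemma sm_cornerK b F : cancel (sm_corner (~~ b) F) (sm_corner b F).
Proof.
move=> c; case: (eqVneq (on_vertex F (cvert c)) set0) => [E|/set0Pn[d]].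
  by rewrite !sm_corner_off.
rewrite inE => /andP[dF dv]; have {}dF := esym (face_eq dF).
have [e1 e2 e3] := sm_cornerE (~~ b) dF.
have [g1 g2 g3] := sm_cornerE b (etrans (fac_next (~~ b) d) dF).
rewrite -(cdartK c); have : vtx d = vtx (cdart c).
  by rewrite -(vertex_eq dv) -{1}(cdartK c).
case/vertexP=> ->.
- by rewrite e1 g1 next_negb.
- by rewrite e2 g2 next_negb.
- by rewrite e3 g3 next_negb.
Qed.

Lemma sm_side_off b F s : on_edge F (val s).2 = set0 -> sm_side b F s = s.
Proof. by move=> E; rewrite /sm_side E; case: pickP => // x; rewrite inE. Qed.

Lemma on_edgeP K x : on_edge K (edg x) != set0 -> K = fac x \/ K = fac (dopp M x).
Proof.
case/set0Pn=> y; rewrite inE => /andP[/face_eq -> /edge_eq/edgeP[]->].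
  by left.
by right.
Qed.

Lemma on_edge1 x : on_edge (fac x) (edg x) != set0.
Proof. by apply/set0Pn; exists x; rewrite inE !porbit_id. Qed.

Lemma on_edge2 x : on_edge (fac (dopp M x)) (edg x) != set0.
Proof. by rewrite -edg_opp on_edge1. Qed.

Lemma sm_sideE b F d (s : side_edge M) : fac d = F -> (val s).2 = edg d ->
  val (sm_side b F s) =
    (if (val s).1 == F then F else fac (dopp M (bnext b d)), edg (bnext b d)).
Proof.
move=> dF se; rewrite /sm_side se (pick_edge dF).
have := valP s; rewrite se => /on_edgeP[] E; rewrite E.
  by rewrite dF eqxx val_insubd /= -dF -(fac_next b) on_edge1.
rewrite -dF [_ == fac d]eq_sym (negbTE (edge_faces d)) eqxx.
by rewrite val_insubd /= on_edge2.
Qed.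

Lemma sm_sideK b F : cancel (sm_side (~~ b) F) (sm_side b F).
Proof.
move=> s; case: (eqVneq (on_edge F (val s).2) set0) => [E|/set0Pn[d]].
  by rewrite !sm_side_off.
rewrite inE => /andP[/face_eq/esym dF /edge_eq de].
have E := @sm_sideE (~~ b) F d s dF de; apply: val_inj.
have dF' : fac (bnext (~~ b) d) = F by rewrite fac_next.
rewrite (@sm_sideE b F _ _ dF'); last by rewrite E.
rewrite E /= next_negb.
rewrite [RHS]surjective_pairing de; congr pair.
have := valP s; rewrite de => /on_edgeP[] Es; rewrite Es.
  by rewrite dF !eqxx.
have -> : fac (dopp M d) == F = false.
  by rewrite -dF eq_sym; apply/negbTE/edge_faces.
by rewrite -[X in _ == X]dF' eq_sym (negbTE (edge_faces _)).
Qed.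

Lemma sm_corner_inj b F : injective (sm_corner b F).
Proof. by rewrite -[b]negbK; apply: can_inj (@sm_cornerK (~~ b) F). Qed.

Lemma sm_side_inj b F : injective (sm_side b F).
Proof. by rewrite -[b]negbK; apply: can_inj (@sm_sideK (~~ b) F). Qed.

Definition sm b F : {perm corner M} * {perm side_edge M} :=
  (perm (@sm_corner_inj b F), perm (@sm_side_inj b F)).

(** [dir F] is the direction chosen for the boundary of [F]. *)
Definition Rubik (dir : face M -> bool)
    : {set {perm corner M} * {perm side_edge M}} :=
  <<[set sm (dir F) F | F : face M]>>%g.

End SideMovement.

(* Main.v *)
Require Import Defs.
From mathcomp Require Import all_boot all_order all_algebra all_fingroup.

(** The corners at a vertex form a free orbit of [crot], of order 3, so [sh] is
    the difference cocycle of a Z_3-torsor over each vertex, and [OrMap M] is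
    the centralizer of [crot].  The sum defining [sh_map] is therefore a
    transfer: it measures how far [f] is from mapping a section of [cvert] to
    itself, it does not depend on the section, and it is a morphism to Z_3.  It
    is nonzero on the rotation of the corners at a single vertex.  A side
    movement of [F] is in its kernel, because it preserves a section that takes,
    at each vertex of [F], the corner belonging to [F]. *)

Set Implicit Arguments.
Unset Strict Implicit.
Unset Printing Implicit Defensive.

Import GRing.Theory.

Lemma iter_modn (T : Type) (f : T -> T) n k x :
  iter n f x = x -> iter (k %% n) f x = iter k f x.
Proof.
by move=> fnx; rewrite [in RHS](divn_eq k n) addnC iterD iterM (iter_fix _ fnx).
Qed.

Lemma morph_iter (T : Type) (f g : T -> T) k :
  {morph f : x / g x} -> {morph f : x / iter k g x}.
Proof. by move=> fg x; elim: k => //= k <-. Qed.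

Section Transfer.
Local Open Scope ring_scope.
Variables (X : Type) (I : finType) (V : zmodType).
Variables (p : X -> I) (delta : X -> X -> V).
Implicit Types (x y z : X) (f g : X -> X) (s t : I -> X).

Definition fiberwise_cocycle := forall x y z,
  p x = p y -> p y = p z -> delta x z = delta x y + delta y z.

Definition fiberwise_isometry f :=
  forall x y, p x = p y -> delta (f x) (f y) = delta x y.

Definition offset s x : V := delta x (s (p x)).

Definition transfer s f : V := \sum_i offset s (f (s i)).

Hypothesis deltaD : fiberwise_cocycle.

Lemma cocycle_refl x : delta x x = 0.
Proof. by apply: (addrI (delta x x)); rewrite -deltaD ?addr0. Qed.

Lemma transfer_eq0 s f : cancel s p ->
  (forall i, exists j, f (s i) = s j) -> transfer s f = 0.
Proof.
move=> sK fs; apply: big1 => i _; have [j ->] := fs i.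
by rewrite /offset sK cocycle_refl.
Qed.

Lemma fiber_action_inj s f : cancel s p -> {mono f : x y / p x == p y} ->
  injective (fun i => p (f (s i))).
Proof. by move=> sK fp i j /eqP; rewrite fp !sK => /eqP. Qed.

Lemma transfer_section s t f : cancel s p -> cancel t p ->
  {mono f : x y / p x == p y} -> fiberwise_isometry f ->
  transfer s f = transfer t f.
Proof.
move=> sK tK fp f_iso; pose h i := p (f (t i)).
have p_fst i : p (f (s i)) = h i by apply/eqP; rewrite fp sK tK.
have offsetE i : offset s (f (s i)) =
    offset t (f (t i)) + delta (s i) (t i) - delta (s (h i)) (t (h i)).
  apply/eqP; rewrite eq_sym subr_eq -f_iso ?sK ?tK // addrC /offset p_fst.
  by rewrite -!deltaD ?sK ?tK.
rewrite /transfer (eq_bigr _ (fun i _ => offsetE i)) sumrB big_split /=.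
by rewrite [X in _ + X - _](reindex_inj (fiber_action_inj tK fp)) /= addrK.
Qed.

Lemma transfer_comp s f g : cancel s p ->
  {mono f : x y / p x == p y} -> fiberwise_isometry f ->
  {mono g : x y / p x == p y} ->
  transfer s (f \o g) = transfer s f + transfer s g.
Proof.
move=> sK fp f_iso gp; pose h i := p (g (s i)).
have pf_gsh i : p (f (g (s i))) = p (f (s (h i))).
  by apply/eqP; rewrite fp sK.
rewrite [X in X + _](reindex_inj (fiber_action_inj sK gp)) -big_split /=.
apply: eq_bigr => i _; rewrite /offset -/(h i) pf_gsh addrC.
by rewrite -(f_iso (g (s i))) -?deltaD ?sK.
Qed.

End Transfer.

Section Shift.
Variable M : cubic_map.
Implicit Types (c : corner M) (v : vertex M) (f g : {perm corner M}).
Implicit Types (phi psi : vertex M -> corner M) (F : face M) (b : bool).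

Lemma crot_dcorner (d : dart M) : crot (dcorner d) = dcorner (drot M d).
Proof. by rewrite /crot dcornerK. Qed.

Lemma crot3 c : iter 3 (@crot M) c = c.
Proof. by rewrite -(cdartK c) /= !crot_dcorner rot3. Qed.

Lemma crot_inj : injective (@crot M).
Proof. by move=> c c' eq_cr; rewrite -(crot3 c) iterSr eq_cr -iterSr crot3. Qed.

Lemma order_crot c : fingraph.order (@crot M) c = 3.
Proof.
rewrite (@order_cycle _ _ (traject (@crot M) c 3)) ?inE ?eqxx //=.
  by rewrite [crot (crot (crot c))]crot3 !eqxx.
have := uniq_traject_porbit (drot M) (cdart c).
rewrite cubicP -(map_inj_uniq (@dcorner_inj M)) /=.
by rewrite -!crot_dcorner cdartK.
Qed.

Lemma cvert_iter_crot k c : cvert (iter k (@crot M) c) = cvert c.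
Proof.
elim: k => //= k <-; set c' := iter k _ _.
by rewrite -[c']cdartK crot_dcorner [LHS]vtx_rot.
Qed.

Lemma cvert_crot c : cvert (crot c) = cvert c.
Proof. exact: (cvert_iter_crot 1). Qed.

Lemma same_cvertP c c' :
  reflect (exists k, c' = iter k (@crot M) c) (cvert c == cvert c').
Proof.
apply: (iffP eqP) => [|[k ->]]; last by rewrite cvert_iter_crot.
rewrite -(cdartK c) -(cdartK c') => /vertexP[] ->.
- by exists 0.
- by exists 1; rewrite /= crot_dcorner.
- by exists 2; rewrite /= !crot_dcorner.
Qed.

Lemma sh_iter_crot k c : sh c (iter k (@crot M) c) = k %% 3.
Proof.
have lt_k3 : k %% 3 < 3 by rewrite ltn_mod.
rewrite /sh -(iter_modn k (crot3 c)).
case: pickP => [i /eqP/(congr1 (findex (@crot M) c))|/(_ (Ordinal lt_k3))] /=.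
  by rewrite !findex_iter ?order_crot.
by rewrite eqxx.
Qed.

Lemma sh_add c c' c'' : cvert c = cvert c' -> cvert c' = cvert c'' ->
  sh c c'' = sh c c' + sh c' c'' %[mod 3].
Proof.
move=> /eqP/same_cvertP[k ->] /eqP/same_cvertP[l ->].
by rewrite -[in LHS]iterD !sh_iter_crot modn_mod modnDm addnC.
Qed.

Definition shift c c' : 'Z_3 := (sh c c')%:R%R.

Lemma shift_cocycle : fiberwise_cocycle (@cvert M) shift.
Proof.
move=> c c' c'' eq_v eq_v'; rewrite /shift -natrD; apply: val_inj.
by rewrite /= !val_Zp_nat //; apply: sh_add.
Qed.

Definition crot_perm : {perm corner M} := perm crot_inj.

Lemma cent1_crotP f :
  reflect {morph f : c / crot c} (f \in 'C[crot_perm])%g.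
Proof.
apply: (iffP cent1P) => [fC c | f_crot].
  by have := congr1 (fun h : {perm corner M} => h c) fC; rewrite !permM !permE.
by apply/permP => c; rewrite !permM !permE f_crot.
Qed.

Lemma crot_morph_mono_cvert f :
  {morph f : c / crot c} -> {mono f : c c' / cvert c == cvert c'}.
Proof.
move=> f_crot c c'; apply/same_cvertP/same_cvertP => -[k eq_k]; exists k.
  by apply: (@perm_inj _ f); rewrite (morph_iter k f_crot).
by rewrite eq_k (morph_iter k f_crot).
Qed.

Lemma crot_morph_imset_corners_at f c : {morph f : c / crot c} ->
  f @: corners_at (cvert c) = corners_at (cvert (f c)).
Proof.
move=> /crot_morph_mono_cvert f_mono; apply/setP=> c'.
by rewrite -[c'](permKV f) mem_imset ?inE ?f_mono //; apply: perm_inj.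
Qed.

Lemma OrMapE : OrMap M = 'C[crot_perm]%g.
Proof.
apply/setP=> f; rewrite inE; apply/andP/cent1_crotP => [[_ /forallP f_crot] c|].
  exact/eqP.
move=> f_crot; split; last by apply/forallP=> c; rewrite f_crot.
apply/forallP=> v; apply/existsP; exists (cvert (f (some_corner v))).
by rewrite -crot_morph_imset_corners_at // some_cornerP.
Qed.

Lemma group_set_OrMap : group_set (OrMap M).
Proof. by rewrite OrMapE groupP. Qed.

Canonical OrMap_group := Group group_set_OrMap.

Lemma OrMapP f : reflect {morph f : c / crot c} (f \in OrMap M).
Proof. by rewrite OrMapE; apply: cent1_crotP. Qed.

Lemma OrMap_mono_cvert f :
  f \in OrMap M -> {mono f : c c' / cvert c == cvert c'}.
Proof. by move/OrMapP; apply: crot_morph_mono_cvert. Qed.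

Lemma corners_at_inj : injective (@corners_at M).
Proof.
move=> v v' /setP/(_ (some_corner v)).
by rewrite !inE some_cornerP eqxx => /esym/eqP.
Qed.

Lemma vact_cvert f c : f \in OrMap M -> vact f (cvert c) = cvert (f c).
Proof.
move/OrMapP=> /(crot_morph_imset_corners_at c) f_at; rewrite /vact f_at.
case: pickP => [v /eqP/corners_at_inj-> // | /(_ (cvert (f c)))].
by rewrite eqxx.
Qed.

Lemma OrMap_isometry f : f \in OrMap M -> fiberwise_isometry (@cvert M) shift f.
Proof.
move=> /OrMapP f_crot c _ /eqP/same_cvertP[k ->].
by rewrite /shift (morph_iter k f_crot) !sh_iter_crot.
Qed.

Lemma sh_sum_transfer f phi : f \in OrMap M -> corner_choice phi ->
  sh_sum phi f = transfer (@cvert M) shift phi f.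
Proof.
move=> fO phiP; apply: eq_bigr => v _.
by rewrite /offset -(vact_cvert (phi v) fO) phiP.
Qed.

Lemma sh_sum_indep f phi psi : f \in OrMap M ->
  corner_choice phi -> corner_choice psi -> sh_sum phi f = sh_sum psi f.
Proof.
move=> fO phiP psiP.
rewrite (sh_sum_transfer fO phiP) (sh_sum_transfer fO psiP).
exact: (transfer_section (@shift_cocycle) phiP psiP
  (OrMap_mono_cvert fO) (@OrMap_isometry _ fO)).
Qed.

Lemma sh_mapE f phi : f \in OrMap M -> corner_choice phi ->
  sh_map f = transfer (@cvert M) shift phi f.
Proof.
move=> fO phiP; rewrite -(sh_sum_transfer fO phiP).
exact: sh_sum_indep fO (@some_cornerP M) phiP.
Qed.

Lemma sh_map_mulg f g : f \in OrMap M -> g \in OrMap M ->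
  sh_map (g * f)%g = (sh_map f + sh_map g)%R.
Proof.
move=> fO gO; have phiP := @some_cornerP M.
have [f_mono g_mono] := (OrMap_mono_cvert fO, OrMap_mono_cvert gO).
have f_iso := @OrMap_isometry _ fO.
rewrite (sh_mapE (groupM gO fO) phiP) (sh_mapE fO phiP) (sh_mapE gO phiP).
rewrite -(transfer_comp (@shift_cocycle) phiP f_mono f_iso g_mono).
by apply: eq_bigr => v _; rewrite permM.
Qed.

Lemma sh_map_morphM :
  {in OrMap M &, {morph @sh_map M : f g / (f * g)%g >-> (f * g)%g}}.
Proof. by move=> f g fO gO; rewrite (sh_map_mulg gO fO) addrC. Qed.

Canonical sh_map_morphism := Morphism sh_map_morphM.

Lemma sh_map_eq0 f phi : f \in OrMap M -> corner_choice phi ->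
  (forall v, exists w, f (phi v) = phi w) -> sh_map f = 0%R.
Proof.
move=> fO phiP f_phi; rewrite (sh_mapE fO phiP).
exact: (transfer_eq0 (@shift_cocycle) phiP f_phi).
Qed.

Definition turn v : {perm corner M} := restr_perm (corners_at v) crot_perm.

Lemma turnE v c : turn v c = if cvert c == v then crot c else c.
Proof.
case: ifPn => [cv | cv]; last first.
  by rewrite (out_perm (restr_perm_on _ _)) // inE.
rewrite restr_permE ?permE //; last by rewrite inE.
by apply/astabsP => c'; rewrite !inE /= /aperm permE cvert_crot.
Qed.

Lemma turn_OrMap v : turn v \in OrMap M.
Proof. by rewrite OrMapE; apply/cent1P/restr_perm_commute. Qed.

Lemma sh_map_turn v : sh_map (turn v) = 2%:R%R.
Proof.
have phiP := @some_cornerP M.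
rewrite (sh_mapE (turn_OrMap v) phiP) /transfer (bigD1 v) //=.
rewrite big1 => [|w /negbTE wv]; rewrite /offset /shift turnE phiP.
  rewrite addr0 eqxx cvert_crot phiP -{2}(crot3 (some_corner v)) iterSr.
  by rewrite sh_iter_crot.
by rewrite wv phiP (sh_iter_crot 0).
Qed.

Lemma on_vertex_cases F v :
  on_vertex F v = set0 \/ exists2 d, fac d = F & vtx d = v.
Proof.
have [|[d]] := set_0Vmem (on_vertex F v); first by left.
by rewrite inE => /andP[/face_eq-> /vertex_eq->]; right; exists d.
Qed.

Lemma sm_corner_iter_crot b F (d : dart M) k : fac d = F ->
  sm_corner b F (iter k (@crot M) (dcorner d)) =
    iter k (@crot M) (dcorner (bnext M b d)).
Proof.
case/(sm_cornerE b) => sm_d sm_rd sm_rrd.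
rewrite -!(iter_modn k (crot3 _)).
by case: (k %% 3) (ltn_pmod k (isT : 0 < 3)) => [|[|[|]]] //= _;
  rewrite !crot_dcorner.
Qed.

Lemma sm_corner_crot b F : {morph sm_corner b F : c / crot c}.
Proof.
move=> c; have [F_off | [d dF /eqP]] := on_vertex_cases F (cvert c).
  by rewrite !sm_corner_off // cvert_crot.
rewrite (_ : vtx d = cvert (dcorner d)) // => /same_cvertP[k ->].
by rewrite -iterS !sm_corner_iter_crot.
Qed.

Lemma sm_OrMap b F : (sm b F).1 \in OrMap M.
Proof. by apply/OrMapP=> c; rewrite !permE sm_corner_crot. Qed.

Definition face_corner F v : corner M :=
  if [pick d in on_vertex F v] is Some d then dcorner d else some_corner v.

Lemma face_corner_dart (d : dart M) : face_corner (fac d) (vtx d) = dcorner d.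
Proof. by rewrite /face_corner (@pick_vertex _ _ _ d) // porbit_id. Qed.

Lemma face_cornerP F : corner_choice (face_corner F).
Proof.
move=> v; rewrite /face_corner; case: pickP => [d|_]; last exact: some_cornerP.
by rewrite inE => /andP[_ /vertex_eq ->].
Qed.

Lemma sm_corner_face_corner b F v :
  exists w, sm_corner b F (face_corner F v) = face_corner F w.
Proof.
have [F_off | [d dF <-]] := on_vertex_cases F v.
  by exists v; rewrite sm_corner_off // face_cornerP.
exists (vtx (bnext M b d)); rewrite -dF face_corner_dart.
by rewrite (sm_corner_iter_crot b 0) // -(fac_next b) face_corner_dart.
Qed.

Lemma sh_map_sm b F : sh_map (sm b F).1 = 0%R.
Proof.
apply: sh_map_eq0 (sm_OrMap b F) (face_cornerP F) _ => v; rewrite permE.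
exact: sm_corner_face_corner.
Qed.

Lemma Rubik_sub_ker_sh_map dir :
  Rubik dir \subset (fst @*^-1 ('ker (@sh_map M)))%g.
Proof.
rewrite gen_subG; apply/subsetP=> _ /imsetP[F _ ->].
apply/morphpreP; split; first exact: in_setT.
by apply/(kerP _ (sm_OrMap (dir F) F)); exact: sh_map_sm.
Qed.

End Shift.

(* [f \o g] is the permutation [(g * f)%g]. *)
Theorem theorem1 (M : cubic_map) :
  [/\ (forall c c' c'' : corner M, cvert c = cvert c' -> cvert c' = cvert c'' ->
         sh c c'' = sh c c' + sh c' c'' %[mod 3]),
      (forall f : {perm corner M}, f \in OrMap M ->
         forall phi psi : vertex M -> corner M,
           corner_choice phi -> corner_choice psi ->
           sh_sum phi f = sh_sum psi f),
      (forall f g : {perm corner M}, f \in OrMap M -> g \in OrMap M ->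
         (g * f)%g \in OrMap M /\
         sh_map (g * f)%g = (sh_map f + sh_map g)%R),
      (exists2 f : {perm corner M}, f \in OrMap M & sh_map f <> 0%R) &
      (forall (dir : face M -> bool) (f : {perm corner M} * {perm side_edge M}),
         f \in Rubik dir -> f.1 \in OrMap M /\ sh_map f.1 = 0%R)].
Proof.
split.
- exact: sh_add.
- by move=> f fO phi psi; apply: sh_sum_indep.
- by move=> f g fO gO; rewrite groupM // sh_map_mulg.
- have /card_gt0P[d _] := dart_gt0 M.
  by exists (turn (vtx d)); [exact: turn_OrMap | rewrite sh_map_turn].
- move=> dir f /(subsetP (Rubik_sub_ker_sh_map dir))/morphpreP[_ f_ker].
  by split; [exact: dom_ker f_ker | exact: mker f_ker].
Qed.
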